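(* There are universal constants $c,C>0$ such that for every $n\in\mathbb N$ we have $c\sqrt n\le \mathsf e(\ell_\infty^n)\le C\sqrt n$.
   Context: All vector spaces are over the real scalars; $\ell_\infty^n$ is $\mathbb R^n$ with the norm $\|x\|_{\ell_\infty^n}=\max_i|x_i|$. For a metric space $(\mathcal M,d_{\mathcal M})$, the Lipschitz extension modulus $\mathsf e(\mathcal M)\in[1,\infty]$ is the infimum over those $L\in[1,\infty]$ such that for every nonempty subset $\mathscr C\subseteq\mathcal M$, every Banach space $\mathbf Z$ and every Lipschitz function $f:\mathscr C\to\mathbf Z$ there is $F:\mathcal M\to\mathbf Z$ with $F|_{\mathscr C}=f$ whose Lipschitz constant on $\mathcal M$ is at most $L$ times the Lipschitz constant of $f$ on $\mathscr C$. *)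

(* Defs.v *)
From HB Require Import structures.
From mathcomp Require Import all_boot all_order all_algebra.
From mathcomp Require Import all_classical all_reals all_analysis.

Set Implicit Arguments.
Unset Strict Implicit.
Unset Printing Implicit Defensive.

Import Order.TTheory GRing.Theory Num.Theory.
Import numFieldNormedType.Exports.

Local Open Scope classical_set_scope.
Local Open Scope ring_scope.

(* The library norm on 'rV[R]_n is mx_norm, the maximum of the absolute values
   of the entries; with the distance below 'rV[R]_n is l_infty^n. *)
Section rV_metric.
Variables (R : realType) (n : nat).
Implicit Types x y : 'rV[R]_n.

Let dist x y : R := `|x - y|.

Let dist_ge0 x y : 0 <= dist x y. Proof. exact: normr_ge0. Qed.

Let dist_positivity x y : dist x y = 0 -> x = y.
Proof. by move/eqP; rewrite normr_eq0 subr_eq0 => /eqP. Qed.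

Let ballEdist x d : ball x d = [set y | dist x y < d].
Proof. by rewrite -ball_normE. Qed.

HB.instance Definition _ :=
  @PseudoMetric_isMetric.Build R 'rV[R]_n dist dist_ge0 dist_positivity
    ballEdist.

End rV_metric.

Lemma rV_mdistE (R : realType) (n : nat) (x y : 'rV[R]_n) :
  mdist x y = `|x - y|.
Proof. by []. Qed.

Definition lip_const (R : realType) (M : metricType R) (Z : normedModType R)
    (A : set M) (f : M -> Z) : \bar R :=
  ereal_inf [set K%:E | K in [set K : R | 0 <= K /\
    forall x y, A x -> A y -> `|f x - f y| <= K * mdist x y]].

(* A function A -> Z is represented by a total function M -> Z of which only the
   values on A matter. In L * lip_const A f the library convention
   +oo * 0 = 0 applies; it does not affect the infimum below, since constant
   functions always extend to constant functions. *)
Definition lip_extendable (R : realType) (M : metricType R) (L : \bar R) : Prop :=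
  forall (A : set M) (Z : completeNormedModType R) (f : M -> Z),
    A !=set0 -> (lip_const A f < +oo)%E ->
    exists F : M -> Z, (forall x, A x -> F x = f x) /\
      (lip_const setT F <= L * lip_const A f)%E.

Definition lip_ext_modulus (R : realType) (M : metricType R) : \bar R :=
  ereal_inf [set L : \bar R | (1 <= L)%E /\ lip_extendable M L].

(* Main.v *)
Require Import Defs.
From HB Require Import structures.
From mathcomp Require Import all_boot all_order all_algebra.
From mathcomp Require Import all_classical all_reals all_analysis.
From mathcomp Require Import ring lra zify.

(** The upper bound. After extending [f] to the closure of its domain, let [A]
    be closed and let [r x] be the distance from [x] to [A]. Outside [A] the
    extension is a weighted average of values of [f] at points of [A] close to
    the nodes [e ^ k * w], with [k] an integer, [w] an integer vector and
    [e ^ k] comparable to [r x]. The weight of a node is the square of an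
    amplitude
      [bump (ln (r x) - k) * \prod_i bump (x_i / e ^ k - w_i)],
    where the squares of the integer translates of [bump] sum to [1]. The
    total variation between the weights at [x] and at [y] is at most a multiple
    of the Euclidean distance between the two unit vectors of amplitudes
    ([sum_sqrB_le]). Their scalar product factorises over the coordinates, and
    each coordinate contributes a factor [1 - O((x_i - y_i) ^ 2 / r x ^ 2)]
    ([weight_corr_ge]), so that the Euclidean distance is
    [O(sqrt n * |x - y| / r x)]: the square root comes from this tensorisation,
    as adding the variations of the coordinates would only give [n]. The values
    being averaged differ by [O(r x)] times the Lipschitz constant of [f],
    hence the extension is [O(sqrt n)]-Lipschitz ([extension_lip]).

    The lower bound. It suffices to treat [m = r ^ 2] coordinates, [r] a power
    of [2], since l_infty^m embeds in l_infty^n as a subspace. Let [H] be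
    Sylvester's Hadamard matrix, so that [H ^ 2 = r ^ 2], let [E] be the space
    of rows [x] with [x H = r x], and [Q = (r + H) / (2 r)] the projection onto
    [E]. For the norm [|x Q| + |x - x Q|] the identity of [E] is an isometry
    and [Q] has norm at most one; an extension of that identity followed by [Q]
    is therefore an [L]-Lipschitz retraction [G] onto [E]. Averaging its
    differences [G (z + u) - G z] with Banach limits, along directions spanning
    [E] and then along the unit vectors, gives a matrix [M] with
    [M H = r M], [(r + H) M = r + H] and [|u M| <= L |u|] for integral [u]
    ([linearization]). The rows of [H] are sign vectors, so
    [tr (H M) <= L m], while the trace of [(r + H) M] is
    [r tr M + tr (H M) = 2 tr (H M)] and equals [r m + tr H >= r m]. Hence
    [L >= r / 2] ([hadamard_lower]). *)

Set Implicit Arguments.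
Unset Strict Implicit.
Unset Printing Implicit Defensive.

Import Order.TTheory GRing.Theory Num.Theory.
Import numFieldNormedType.Exports.

Local Open Scope classical_set_scope.
Local Open Scope ring_scope.

(** * Lipschitz functions and the supremum norm *)

Definition lip_on (R : realType) (M : metricType R) (Z : normedModType R)
    (K : R) (A : set M) (f : M -> Z) :=
  forall x y, A x -> A y -> `|f x - f y| <= K * mdist x y.

Section LipConst.
Variables (R : realType) (M : metricType R) (Z : normedModType R).
Implicit Types (A : set M) (f : M -> Z) (K : R).

Lemma lip_const_le A f K : 0 <= K -> lip_on K A f -> (lip_const A f <= K%:E)%E.
Proof. by move=> K0 fK; apply: ereal_inf_lbound; exists K. Qed.

(** The infimum defining [lip_const] is attained. *)
Lemma lip_on_const A f K : (lip_const A f <= K%:E)%E -> lip_on K A f.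
Proof.
move=> fK x y Ax Ay; apply/ler_addgt0Pr => e e0.
set d := mdist x y; have d1 : 0 < d + 1 by rewrite ltr_wpDl// mdist_ge0.
have : (lip_const A f < (K + e / (d + 1))%:E)%E.
  by rewrite (le_lt_trans fK)// lte_fin ltrDl divr_gt0.
move=> /ereal_inf_lt[_ [K' [_ fK'] <-]]; rewrite lte_fin => K'K.
apply: (le_trans (fK' _ _ Ax Ay)); rewrite -/d.
apply: (@le_trans _ _ ((K + e / (d + 1)) * d)).
  by rewrite ler_wpM2r ?mdist_ge0 // ltW.
rewrite mulrDl lerD2l mulrAC ler_pdivrMr// ler_pM2l//.
by rewrite lerDl.
Qed.

Lemma lip_const_ge0 A f : (0 <= lip_const A f)%E.
Proof. by apply: le_ereal_inf_tmp => _ [K [K0 _] <-]; rewrite lee_fin. Qed.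

Lemma lip_const_fin A f : (lip_const A f < +oo)%E ->
  exists K, [/\ 0 <= K, lip_const A f = K%:E & lip_on K A f].
Proof.
move=> foo; have K0 := lip_const_ge0 A f.
have fin : lip_const A f \is a fin_num by rewrite ge0_fin_numE.
exists (fine (lip_const A f)); split; first exact: fine_ge0.
  by rewrite fineK.
by apply: lip_on_const; rewrite fineK.
Qed.

End LipConst.

(** The distance of the set to an exterior point must be positive for the
    averaging scheme below; limit points of the set are therefore treated
    first, by completeness of the target. *)
Lemma lip_closure (R : realType) (M : metricType R)
    (Z : completeNormedModType R) (A : set M) (f : M -> Z) (K : R) :
  0 <= K -> lip_on K A f ->
  exists g : M -> Z, (forall x, A x -> g x = f x) /\ lip_on K (closure A) g.
Proof.
move=> K0 fK.
have near x e : closure A x -> 0 < e -> exists2 b, A b & mdist x b < e.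
  move=> clx e0; have [b [Ab]] := clx _ (nbhsx_ballx x _ e0).
  by rewrite ballEmdist; exists b.
have pt x : exists z, closure A x -> forall a, A a -> `|f a - z| <= K * mdist a x.
  have [clx|nclx] := pselect (closure A x); last by exists 0.
  pose F := within A (nbhs x).
  have FF : ProperFilter F by exact: within_nbhs_proper.
  have nearF e : 0 < e -> F [set b | A b /\ mdist x b < e].
    move=> e0; rewrite /F /within /=; near=> b => Ab; split=> //.
    suff : ball x e b by rewrite ballEmdist.
    by near: b; exact: nbhsx_ballx.
  have fcvg : cvg (f @ F).
    apply: cauchy_cvg; apply: cauchy_exP => e e0.
    pose d := e / (2 * (K + 1)).
    have K1 : 0 < K + 1 by rewrite ltr_wpDl.
    have d0 : 0 < d by rewrite divr_gt0// mulr_gt0.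
    have [b Ab xb] := near _ _ clx d0.
    exists (f b); rewrite /=; apply: filterS (nearF _ d0) => a [Aa xa].
    rewrite -ball_normE /=; apply: (le_lt_trans (fK _ _ Ab Aa)).
    have : mdist b a <= 2 * d.
      rewrite (le_trans (metric_triangle _ x _))// metric_sym; lra.
    have de : 2 * d * (K + 1) = e by rewrite /d; field; lra.
    move=> bad; apply: (@le_lt_trans _ _ (K * (2 * d))); first by rewrite ler_wpM2l.
    by rewrite -de; nra.
  exists (lim (f @ F)) => _ a Aa; apply/ler_addgt0Pr => e e0.
  pose d := e / (2 * (K + 1)).
  have K1 : 0 < K + 1 by rewrite ltr_wpDl.
  have d0 : 0 < d by rewrite divr_gt0// mulr_gt0.
  have e20 : 0 < e / 2 by rewrite divr_gt0.
  have /cvgrPdist_lt/(_ _ e20) fl := fcvg.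
  near F => b.
  have [Ab xb] : A b /\ mdist x b < d by near: b; exact: nearF.
  have lb : `|lim (f @ F) - f b| < e / 2 by near: b.
  rewrite -(subrKA (f b)) (le_trans (ler_normD _ _))//.
  rewrite [X in _ + X]distrC.
  have := fK _ _ Aa Ab; have := metric_triangle a x b.
  have de : 2 * d * (K + 1) = e by rewrite /d; field; lra.
  move=> t1 t2.
  have : K * mdist a b <= K * (mdist a x + d) by rewrite ler_wpM2l//; lra.
  by nra.
have [g gP] := choice pt.
exists (fun x => if pselect (A x) then f x else g x); split.
  by move=> x Ax; case: pselect.
have {}gP x a : closure A x -> A a ->
    `|f a - (if pselect (A x) then f x else g x)| <= K * mdist a x.
  by move=> clx Aa; case: pselect => // Ax; [exact: fK|exact: gP].
move=> x y clx cly; apply/ler_addgt0Pr => e e0.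
set gx := (X in `|X - _|); set gy := (X in `|_ - X|).
pose d := e / (4 * (K + 1)).
have K1 : 0 < K + 1 by rewrite ltr_wpDl.
have d0 : 0 < d by rewrite divr_gt0// mulr_gt0.
have de : 4 * d * (K + 1) = e by rewrite /d; field; lra.
have [a Aa xa] := near _ _ clx d0; have [b Ab yb] := near _ _ cly d0.
have := gP _ _ clx Aa; have := gP _ _ cly Ab; rewrite -/gx -/gy => gb ga.
have tx : `|gx - gy| <= `|f a - gx| + `|f a - f b| + `|f b - gy|.
  have -> : gx - gy = - (f a - gx) + (f a - f b) + (f b - gy).
    by rewrite opprB !subrKA.
  by rewrite (le_trans (ler_normD _ _))// lerD2r (le_trans (ler_normD _ _))// normrN.
have fab := fK _ _ Aa Ab.
have ab : mdist a b <= mdist a x + (mdist x y + mdist y b).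
  by rewrite (le_trans (metric_triangle _ x _))// lerD2l metric_triangle.
rewrite metric_sym in xa.
have {}fab : `|f a - f b| <= K * (mdist x y + 2 * d).
  by rewrite (le_trans fab)// ler_wpM2l//; lra.
have {}ga : `|f a - gx| <= K * d by rewrite (le_trans ga)// ler_wpM2l// ltW.
have {}gb : `|f b - gy| <= K * d.
  by rewrite (le_trans gb)// ler_wpM2l// metric_sym ltW.
by nra.
Unshelve. all: by end_near. Qed.

Lemma rV_norm_leP (R : realType) (n : nat) (x : 'rV[R]_n) (b : R) : 0 <= b ->
  (forall i, `|x 0 i| <= b) <-> `|x| <= b.
Proof.
move=> b0; rewrite [X in X <= b]/Num.norm/= mx_normrE; split => [xb|/bigmax_leP[_ xb] i].
  by apply/bigmax_leP; split=> //= -[j i] _ /=; rewrite ord1.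
by have := xb (0, i) isT.
Qed.

Lemma rV_norm_coord (R : realType) (n : nat) (x : 'rV[R]_n) i : `|x 0 i| <= `|x|.
Proof. by move: i; apply/rV_norm_leP. Qed.

Lemma mulmx_norm_le (R : realType) (m n : nat) (M : 'M[R]_(m, n)) :
  exists2 B, 0 <= B & forall u : 'rV[R]_m, `|u *m M| <= B * `|u|.
Proof.
exists (\sum_i \sum_j `|M i j|) => [|u].
  by apply: sumr_ge0 => i _; apply: sumr_ge0.
apply/rV_norm_leP => [|j]; first by rewrite mulr_ge0// sumr_ge0// => i _; exact: sumr_ge0.
rewrite mxE (le_trans (ler_norm_sum _ _ _))// mulr_suml ler_sum// => i _.
rewrite normrM mulrC ler_pM ?rV_norm_coord//.
by rewrite (bigD1 j)//= lerDl sumr_ge0.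
Qed.

(** * A partition of unity with square-summable amplitudes *)

Section Bump.
Variable R : realType.
Implicit Types t u : R.

(** One arch of the cosine, supported on [[-1, 1]]. On a cell of length one only
    two integer translates are nonzero, and they are the cosine and the sine of
    the same angle; this is why their squares sum to [1]. *)
Definition bump t : R := cos (pi / 2 * Num.min 1 `|t|).

Lemma bump_ge0 t : 0 <= bump t.
Proof.
have [p0 p2] := @pihalf_02_cos_pihalf R.
apply: cos_ge0_pihalf.
have m0 : 0 <= Num.min 1 `|t| by rewrite le_min ler01 normr_ge0.
have m1 : Num.min 1 `|t| <= 1 by rewrite ge_min lexx.
by nra.
Qed.

Lemma bump_eq0 t : 1 <= `|t| -> bump t = 0.
Proof. by move=> t1; rewrite /bump min_l// mulr1 cos_pihalf. Qed.

Lemma bump_lt1 t : bump t != 0 -> `|t| < 1.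
Proof. by move=> t0; rewrite ltNge; apply: contraNN t0 => /bump_eq0/eqP. Qed.

Lemma cos_lip t u : `|cos t - cos u| <= `|t - u|.
Proof.
wlog tu : t u / t <= u.
  by move=> h; have [/h//|/ltW/h] := leP t u; rewrite distrC [X in _ <= X]distrC.
have [x _] := @MVT_segment R cos (- sin) t u tu (fun x _ => is_derive_cos x)
  ltac:(by apply: continuous_subspaceT => x; exact: continuous_cos).
rewrite distrC [X in _ <= X]distrC => ->.
by rewrite normrM ler_piMl// normrN sin_max.
Qed.

Lemma bump_lip t u : `|bump t - bump u| <= 2 * `|t - u|.
Proof.
rewrite /bump; apply: (le_trans (cos_lip _ _)).
have [/andP[p0 p2] _] := @pihalf_02_cos_pihalf R.
rewrite -mulrBr normrM (ger0_norm p0) ler_pM//.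
apply: (@le_trans _ _ `| `|t| - `|u| |); last exact: ler_dist_dist.
by have [] := leP 1 `|t|; have [] := leP 1 `|u|; rewrite ?subrr ?normr0//;
  move=> *; rewrite !ler_norml; case: (ger0P (`|t| - `|u|)) => *; lra.
Qed.

Lemma bump_sqrD t : 0 <= t <= 1 -> bump t ^+ 2 + bump (t - 1) ^+ 2 = 1.
Proof.
move=> /andP[t0 t1]; rewrite /bump ger0_norm// min_r//.
rewrite ler0_norm ?subr_le0// opprB min_r; last by rewrite lerBlDr lerDl.
by rewrite mulrBr mulr1 -[X in _ + X ^+ 2]cosN opprB cosBpihalf cos2Dsin2.
Qed.

(** The integers of the interval [[- N, N[], listed by an ordinal. *)
Definition site N (j : 'I_(N.*2)) : int := j%:Z - N%:Z.

Lemma site_inj N : injective (@site N).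
Proof. by move=> i j /(congr1 (fun z => z + N%:Z)); rewrite /site !subrK => -[] /val_inj. Qed.

Lemma siteP N (m : int) : - N%:Z <= m < N%:Z -> exists j, @site N j = m.
Proof.
move=> /andP[m0 m1].
have jN : (`|(m + N%:Z)%R| < N.*2)%N by lia.
exists (Ordinal jN); rewrite /site /=; lia.
Qed.

Lemma floor_window t N : `|t| + 1 < N%:R ->
  - N%:Z <= Num.floor t /\ Num.floor t + 1 < N%:Z.
Proof.
move=> tN; have := ler_norm t; have := ler_norm (- t); rewrite normrN => a b.
rewrite floor_ge_int -ltrBrDr floor_lt_int intrB intrN; split; lra.
Qed.

Lemma dist_lt_floor t (z : int) (k : nat) : `|t - z%:~R| < k%:R ->
  Num.floor t - k%:Z < z <= Num.floor t + k%:Z.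
Proof.
rewrite ltr_distl => /andP[a b].
rewrite ltrBlDr floor_lt_int -lerBlDr floor_ge_int intrB intrD /=.
by rewrite b ltW.
Qed.

Lemma sum_bump t N : `|t| + 1 < N%:R ->
  \sum_(j < N.*2) bump (t - (site j)%:~R) ^+ 2 = 1.
Proof.
move=> tN; set m := Num.floor t.
have [f1 f2] := floor_window tN.
have [j0 Ej0] := @siteP N m ltac:(by rewrite /m; lia).
have [j1 Ej1] := @siteP N (m + 1) ltac:(by rewrite /m; lia).
have j01 : j1 != j0 by apply/eqP => E; move: Ej1; rewrite E Ej0; lia.
rewrite (bigD1 j0)//= (bigD1 j1)//= big1 ?addr0; last first.
  move=> j /andP[jj0 jj1]; rewrite bump_eq0 ?expr0n//.
  rewrite leNgt; apply/negP => /(@dist_lt_floor _ _ 1) mj.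
  have : site j = m \/ site j = m + 1 by rewrite /m; lia.
  case=> [|]; first by rewrite -Ej0 => /site_inj ej; rewrite ej eqxx in jj0.
  by rewrite -Ej1 => /site_inj ej; rewrite ej eqxx in jj1.
have := bump_sqrD (t := t - m%:~R); rewrite Ej0 Ej1 intrD opprD addrA; apply.
by rewrite subr_ge0 floor_le lerBlDl -[1]/(1%:~R) -intrD ltW// floorD1_gt.
Qed.

(** The scalar product of two unit vectors is one minus half of their squared
    distance. At most four translates of [bump] differ at [t] and [u] when
    [`|t - u| < 1], and each one is [2]-Lipschitz, whence [16 / 2 = 8]. *)
Lemma bump_corr t u N : `|t| + 1 < N%:R -> `|u| + 1 < N%:R ->
  1 - 8 * (t - u) ^+ 2 <=
  \sum_(j < N.*2) bump (t - (site j)%:~R) * bump (u - (site j)%:~R).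
Proof.
move=> tN uN.
set b := fun (v : R) (j : 'I_(N.*2)) => bump (v - (site j)%:~R).
rewrite -/(b t _).
have [tu1|tu1] := leP 1 `|t - u|.
  have : 1 <= (t - u) ^+ 2 by rewrite -real_normK ?num_real// expr_ge1.
  have : 0 <= \sum_(j < N.*2) b t j * b u j.
    by apply: sumr_ge0 => j _; rewrite mulr_ge0// bump_ge0.
  lra.
suff h : \sum_(j < N.*2) (b t j - b u j) ^+ 2 <= 16 * (t - u) ^+ 2.
  have E : \sum_(j < N.*2) (b t j - b u j) ^+ 2 =
      \sum_(j < N.*2) b t j ^+ 2 + \sum_(j < N.*2) b u j ^+ 2
      - 2 * \sum_(j < N.*2) b t j * b u j.
    rewrite mulr_sumr -big_split/= -sumrB.
    by apply: eq_bigr => j _; ring.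
  by rewrite E !sum_bump// in h; rewrite /b in h *; lra.
pose m := Num.floor t.
pose s : seq int := [:: m - 1; m; m + 1; m + 2].
have card4 : (#|[pred j : 'I_(N.*2) | site j \in s]| <= 4)%N.
  rewrite cardE -(size_map (@site N)); apply: (@uniq_leq_size _ _ s).
    by rewrite map_inj_uniq ?enum_uniq//; exact: site_inj.
  by move=> z /mapP[j]; rewrite mem_enum inE => js ->.
apply: (@le_trans _ _ (\sum_(j < N.*2 | site j \in s) 4 * (t - u) ^+ 2)).
  rewrite [leRHS]big_mkcond; apply: ler_sum => j _; case: ifPn => js.
    rewrite -[X in X <= _]real_normK ?num_real//.
    rewrite -[X in _ <= 4 * X]real_normK ?num_real//.
    have -> : 4 * `|t - u| ^+ 2 = (2 * `|t - u|) ^+ 2 by ring.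
    rewrite ler_sqr ?nnegrE ?mulr_ge0//.
    have -> : t - u = (t - (site j)%:~R) - (u - (site j)%:~R) by ring.
    exact: bump_lip.
  have tj : 2 <= `|t - (site j)%:~R|.
    rewrite leNgt; apply/negP => /(@dist_lt_floor _ _ 2); rewrite -/m => mj.
    by move: js; rewrite !inE; lia.
  rewrite /b !bump_eq0 ?subrr ?expr0n//; last lra.
  have := ler_distD u t (site j)%:~R; lra.
rewrite sumr_const -mulr_natl.
have c4 : (#|[pred j : 'I_(N.*2) | site j \in s]|%:R <= 4 :> R) by rewrite (ler_nat R _ 4).
have := sqr_ge0 (t - u); nra.
Qed.

End Bump.

(** A form of the comparison of total variation with Hellinger distance: from
    [a ^ 2 - b ^ 2 = (a - b) * (a + b)], by Cauchy-Schwarz, the left side is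
    controlled by the Euclidean distance between the unit vectors [a] and [b]. *)
Lemma sum_sqrB_le (R : realFieldType) (I : Type) (s : seq I) (a b : I -> R) (e : R) :
  0 < e -> \sum_(p <- s) a p ^+ 2 = 1 -> \sum_(p <- s) b p ^+ 2 = 1 ->
  1 - e ^+ 2 / 2 <= \sum_(p <- s) a p * b p ->
  \sum_(p <- s) `|a p ^+ 2 - b p ^+ 2| <= 3 * e.
Proof.
move=> e0 a1 b1 ab.
have E : \sum_(p <- s) ((a p - b p) ^+ 2 / (2 * e)
      + e * (a p ^+ 2 + b p ^+ 2)) =
    (1 + 1 - 2 * \sum_(p <- s) a p * b p) / (2 * e) + e * (1 + 1).
  transitivity ((\sum_(p <- s) a p ^+ 2 + \sum_(p <- s) b p ^+ 2
     - 2 * \sum_(p <- s) a p * b p) / (2 * e)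
     + e * (\sum_(p <- s) a p ^+ 2 + \sum_(p <- s) b p ^+ 2)); last by rewrite a1 b1.
  rewrite [in RHS]mulr_sumr -!big_split/= -sumrB mulr_suml mulr_sumr -big_split/=.
  by apply: eq_bigr => p _; congr (_ / _ + _); ring.
apply: (@le_trans _ _ (\sum_(p <- s) ((a p - b p) ^+ 2 / (2 * e)
      + e * (a p ^+ 2 + b p ^+ 2)))).
  apply: ler_sum => p _; rewrite subr_sqr normrM.
  set u := a p - b p; set v := a p + b p.
  have -> : e * (a p ^+ 2 + b p ^+ 2) = e / 2 * (v ^+ 2 + u ^+ 2).
    by rewrite /u /v; field.
  have : 0 <= (`|u| - e * `|v|) ^+ 2 / (2 * e).
    by rewrite divr_ge0 ?sqr_ge0// mulr_ge0// ltW.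
  have -> : (`|u| - e * `|v|) ^+ 2 / (2 * e)
     = `|u| ^+ 2 / (2 * e) + e / 2 * `|v| ^+ 2 - `|u| * `|v|.
    by field; lra.
  rewrite !real_normK ?num_real//; have := sqr_ge0 u; nra.
rewrite E.
have : (1 + 1 - 2 * \sum_(p <- s) a p * b p) / (2 * e) <= e.
  by rewrite ler_pdivrMr; nra.
by lra.
Qed.

Lemma prod_ge1B (R : realDomainType) (I : Type) (s : seq I) (u : I -> R) :
  (forall i, 0 <= u i <= 1) ->
  1 - \sum_(i <- s) (1 - u i) <= \prod_(i <- s) u i.
Proof.
move=> u01.
suff [] : 0 <= \prod_(i <- s) u i <= 1 /\
  1 - \sum_(i <- s) (1 - u i) <= \prod_(i <- s) u i by [].
elim/big_rec2: _ => [|i P S _ [/andP[P0 P1] PS]]; first by rewrite ler01 subr0 lexx.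
have /andP[v0 v1] := u01 i; split; last nra.
by apply/andP; split; [rewrite mulr_ge0|rewrite mulr_ile1].
Qed.

Section Kernel.
Variables (R : realType) (n : nat).
Implicit Types (x y : 'rV[R]_n) (l m : R).

(** The pair [(k, w)] stands for the node [expR k * w]. *)
Definition node_index := (int * {ffun 'I_n -> int})%type.

(** Here [l] is to be the logarithm of the distance from [x] to the domain of
    the function being extended. *)
Definition weight l x (p : node_index) : R :=
  bump (l - p.1%:~R) * \prod_i bump (x 0 i / expR p.1%:~R - (p.2 i)%:~R).

Definition site_code N (q : 'I_(N.*2) * {ffun 'I_n -> 'I_(N.*2)}) : node_index :=
  (site q.1, [ffun i => site (q.2 i)]).

(** Only finitely many amplitudes at a given point are nonzero, but which ones
    depends on the point. Windows are finite sets of nodes, increasing with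
    [N], in which the averages at two points can be compared. *)
Definition window N : seq node_index := [seq @site_code N q | q in predT].

Lemma site_code_inj N : injective (@site_code N).
Proof.
move=> [k w] [k' w'] [/site_inj-> /ffunP ww]; congr pair; apply/ffunP => i.
by have := ww i; rewrite !ffunE => /site_inj.
Qed.

Lemma window_uniq N : uniq (window N).
Proof. by rewrite map_inj_uniq ?enum_uniq//; exact: site_code_inj. Qed.

(** Outside of the window every amplitude at [x] vanishes; the scales [k] with
    [`|l - k%:~R| >= 1] do not contribute, so that the coordinates of
    [x / expR k] need a bound only for the others. *)
Definition window_fits N l x := `|l| + 1 < N%:R /\
  forall k : int, `|l - k%:~R| < 1 -> forall i, `|x 0 i / expR k%:~R| + 1 < N%:R.

Lemma window_fits_ex l x : exists N0, forall N, (N0 <= N)%N -> window_fits N l x.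
Proof.
pose B := `|l| + `|x| / expR (l - 1) + 1.
have B0 : 0 <= B by rewrite !addr_ge0// divr_ge0// expR_ge0.
exists (Num.truncn B).+1 => N N0N.
have BN : B < N%:R by rewrite (lt_le_trans (truncnS_gt _))// ler_nat.
have l0 := normr_ge0 l.
have x0 : 0 <= `|x| / expR (l - 1) by rewrite divr_ge0// expR_ge0.
split=> [|k lk i]; first by rewrite /B in BN; lra.
suff : `|x 0 i / expR k%:~R| <= `|x| / expR (l - 1) by rewrite /B in BN; lra.
rewrite normrM ler_pM// ?rV_norm_coord//.
rewrite ger0_norm ?invr_ge0 ?expR_ge0// lef_pV2 ?posrE ?expR_gt0// ler_expR.
by move: lk; rewrite ltr_norml => /andP[_]; lra.
Qed.

Lemma site_ex N (t : R) (z : int) : `|t| + 1 < N%:R -> `|t - z%:~R| < 1 ->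
  exists j, @site N j = z.
Proof.
move=> tN tz; apply: siteP; have [a b] := floor_window tN.
by have := @dist_lt_floor _ t z 1 tz; lia.
Qed.

Lemma weight_window N l x p : window_fits N l x -> weight l x p != 0 -> p \in window N.
Proof.
case: p => k w [lN xN]; rewrite mulf_eq0 negb_or /= => /andP[/bump_lt1 lk].
move=> /prodf_neq0 wx; have [j jk] := site_ex lN lk.
have /choice[v vP] : forall i, exists j, @site N j = w i.
  by move=> i; apply: site_ex (xN _ lk i) _; apply: bump_lt1; exact: wx.
apply/mapP; exists (j, finfun v); first by rewrite mem_enum.
by rewrite /site_code /= jk; congr pair; apply/ffunP => i; rewrite !ffunE vP.
Qed.

(** Distributivity turns the sum over integer vectors of a product over the
    coordinates into the product of one-dimensional sums. *)
Lemma weight_corrE N l x m y :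
  \sum_(p <- window N) weight l x p * weight m y p =
  \sum_(k < N.*2) bump (l - (site k)%:~R) * bump (m - (site k)%:~R) *
    \prod_i \sum_(j < N.*2) bump (x 0 i / expR (site k)%:~R - (site j)%:~R) *
                            bump (y 0 i / expR (site k)%:~R - (site j)%:~R).
Proof.
rewrite big_map big_enum /=.
under [RHS]eq_bigr => k _ do rewrite bigA_distr_bigA mulr_sumr.
rewrite pair_big /=; apply: eq_bigr => -[k w] _ /=.
rewrite /weight /= mulrACA -big_split /=; congr (_ * _).
by apply: eq_bigr => i _; rewrite ffunE.
Qed.

Lemma sum_weight_sqr N l x : window_fits N l x -> \sum_(p <- window N) weight l x p ^+ 2 = 1.
Proof.
move=> [lN xN]; rewrite (weight_corrE N l x l x).
apply: etrans (sum_bump lN); apply: eq_bigr => k _; have [->|/bump_lt1 lk] := eqVneq (bump (l - (site k)%:~R)) 0.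
  by rewrite !mul0r expr0n.
rewrite big1 ?mulr1// => i _.
exact: sum_bump (xN _ lk i).
Qed.

(** Each coordinate loses at most [8 * (x_i - y_i) ^ 2 / s ^ 2] at the scale
    [s], and the losses of a product of numbers of [[0, 1]] add up at most.
    Here [B] bounds the losses at all the scales that matter for [x]. *)
Lemma weight_corr_ge N l x m y (B : R) : window_fits N l x -> window_fits N m y ->
  (forall k : int, `|l - k%:~R| < 1 ->
     \sum_i (x 0 i / expR k%:~R - y 0 i / expR k%:~R) ^+ 2 <= B) ->
  1 - 8 * ((l - m) ^+ 2 + B) <=
  \sum_(p <- window N) weight l x p * weight m y p.
Proof.
move=> [lN xN] [mN yN] hB; rewrite weight_corrE.
have S1 : \sum_(k < N.*2) bump (l - (site k)%:~R) * bump (m - (site k)%:~R) <= 1.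
  have : \sum_(k < N.*2) bump (l - (site k)%:~R) * bump (m - (site k)%:~R) <=
      2^-1 * (\sum_(k < N.*2) bump (l - (site k)%:~R) ^+ 2
              + \sum_(k < N.*2) bump (m - (site k)%:~R) ^+ 2).
    rewrite -big_split mulr_sumr; apply: ler_sum => k _ /=.
    have := sqr_ge0 (bump (l - (site k)%:~R) - bump (m - (site k)%:~R)); nra.
  by rewrite !sum_bump//; lra.
have S2 := bump_corr lN mN.
have [k0 lk0] : exists k : int, `|l - k%:~R| < 1.
  exists (Num.floor l); rewrite ger0_norm ?subr_ge0 ?floor_le//.
  by rewrite ltrBlDl -[1]/(1%:~R) -intrD floorD1_gt.
have B0 : 0 <= B.
  by apply: le_trans (hB _ lk0); apply: sumr_ge0 => i _; exact: sqr_ge0.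
apply: (@le_trans _ _ (\sum_(k < N.*2)
   bump (l - (site k)%:~R) * bump (m - (site k)%:~R) * (1 - 8 * B))).
  by rewrite -mulr_suml; nra.
apply: ler_sum => k _.
have [->|] := eqVneq (bump (l - (site k)%:~R)) 0; first by rewrite !mul0r.
have [->|] := eqVneq (bump (m - (site k)%:~R)) 0; first by rewrite mulr0 !mul0r.
move=> /bump_lt1 mk /bump_lt1 lk.
rewrite ler_wpM2l ?mulr_ge0 ?bump_ge0//.
set s := expR _.
apply: le_trans (prod_ge1B _ _) => [|i]; last first.
  rewrite sumr_ge0 => [|j _]; last by rewrite mulr_ge0 ?bump_ge0.
  have : \sum_(j < N.*2) bump (x 0 i / s - (site j)%:~R) * bump (y 0 i / s - (site j)%:~R)
   <= 2^-1 * (\sum_(j < N.*2) bump (x 0 i / s - (site j)%:~R) ^+ 2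
              + \sum_(j < N.*2) bump (y 0 i / s - (site j)%:~R) ^+ 2).
    rewrite -big_split mulr_sumr; apply: ler_sum => j _ /=.
    have := sqr_ge0 (bump (x 0 i / s - (site j)%:~R) - bump (y 0 i / s - (site j)%:~R)); nra.
  by rewrite !sum_bump ?xN ?yN//; lra.
rewrite lerD2l lerN2 (@le_trans _ _ (\sum_i 8 * (x 0 i / s - y 0 i / s) ^+ 2))//.
  apply: ler_sum => i _; rewrite lerBlDl -lerBlDr.
  by apply: bump_corr; [exact: xN|exact: yN].
by rewrite -mulr_sumr ler_wpM2l// hB.
Qed.

End Kernel.

(** * Extension with constant of order sqrt n *)

Lemma ln_dist_le (R : realType) (r s : R) : 0 < r -> r / 2 <= s ->
  `|ln r - ln s| <= 2 * `|r - s| / r.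
Proof.
move=> r0 rs; have s0 : 0 < s by lra.
have lnB (a b : R) : 0 < a -> 0 < b -> ln a - ln b <= (a - b) / b.
  move=> a0 b0; rewrite -ln_div ?posrE//.
  have -> : a / b = 1 + (a - b) / b by field; lra.
  apply: le_ln1Dx; rewrite mulrBl divff ?gt_eqF//.
  by rewrite ltrBrDl subrr divr_gt0.
have i0 : 0 < r^-1 by rewrite invr_gt0.
have [sr|rs'] := leP s r.
  rewrite !ger0_norm ?subr_ge0 ?ler_ln ?posrE//.
  apply: (le_trans (lnB _ _ r0 s0)).
  rewrite ler_pdivrMr//.
  have -> : 2 * (r - s) / r * s = (r - s) * (2 * (s / r)) by ring.
  rewrite ler_peMr ?subr_ge0//.
  by rewrite mulrA ler_pdivlMr//; lra.
rewrite !ltr0_norm ?subr_lt0 ?ltr_ln ?posrE// !opprB.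
apply: (le_trans (lnB _ _ s0 r0)).
rewrite ler_wpM2r ?ltW//; lra.
Qed.

Section Gap.
Variables (R : realType) (n : nat) (A : set 'rV[R]_n).
Hypotheses (A0 : A !=set0) (Acl : closed A).
Implicit Types x y a : 'rV[R]_n.

Definition gap x : R := inf [set `|x - a| | a in A].

Lemma gap_has_inf x : has_inf [set `|x - a| | a in A].
Proof.
split; first by case: A0 => a Aa; exists `|x - a|, a.
by exists 0 => _ [a _ <-].
Qed.

Lemma gap_le x a : A a -> gap x <= `|x - a|.
Proof. by move=> Aa; apply: ge_inf; [case: (gap_has_inf x)|exists a]. Qed.

Lemma gap_ge0 x : 0 <= gap x.
Proof.
by apply: lb_le_inf; [case: (gap_has_inf x)|move=> _ [a _ <-]].
Qed.

Lemma gap_lt x e : 0 < e -> exists2 a, A a & `|x - a| < gap x + e.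
Proof.
move=> e0; have [_ [a Aa <-] xa] := inf_adherent e0 (gap_has_inf x).
by exists a.
Qed.

Lemma gap_lip x y : gap x <= gap y + `|x - y|.
Proof.
apply/ler_addgt0Pr => e e0; have [a Aa ya] := gap_lt y e0.
apply: (le_trans (gap_le x Aa)); have := ler_distD y x a; lra.
Qed.

Lemma gap_gt0 x : ~ A x -> 0 < gap x.
Proof.
move=> nAx; rewrite lt_def gap_ge0 andbT; apply/eqP => g0; apply: nAx.
apply: Acl => B /nbhs_ballP[e /= e0 xB].
have [a Aa] := gap_lt x e0; rewrite g0 add0r => xa.
exists a; split=> //; apply: xB; rewrite -ball_normE; exact: xa.
Qed.

Lemma gap_eq0 x : A x -> gap x = 0.
Proof.
move=> Ax; apply/eqP; rewrite eq_le gap_ge0 andbT.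
by rewrite (le_trans (gap_le x Ax))// subrr normr0.
Qed.

Lemma near_point x : exists a, A a /\ `|x - a| <= 2 * gap x.
Proof.
have [Ax|/gap_gt0 g0] := pselect (A x).
  by exists x; rewrite subrr normr0 mulr_ge0 ?gap_ge0.
by have [a Aa xa] := gap_lt x g0; exists a; split=> //; rewrite ltW//; lra.
Qed.

End Gap.

Lemma expR1_ge2 (R : realType) : 2 <= expR 1 :> R.
Proof. by have := expR_ge1Dx (1 : R); lra. Qed.

Section Extension.
Variables (R : realType) (n : nat) (Z : normedModType R).
Variables (A : set 'rV[R]_n) (f : 'rV[R]_n -> Z) (K : R).
Hypotheses (n0 : (0 < n)%N) (A0 : A !=set0) (Acl : closed A).
Hypotheses (K0 : 0 <= K) (fK : lip_on K A f).
(* Points of A that are closest up to a factor 2; in particular g fixes A. *)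
Variable g : 'rV[R]_n -> 'rV[R]_n.
Hypotheses (gA : forall x, A (g x)) (gP : forall x, `|x - g x| <= 2 * gap A x).
Implicit Types x y : 'rV[R]_n.

Let e : R := expR 1.
Let r := gap A.
Let wt x (p : node_index n) : R := weight (ln (r x)) x p.

Definition node (p : node_index n) : 'rV[R]_n := \row_i (expR p.1%:~R * (p.2 i)%:~R).

Definition extension x : Z :=
  if pselect (A x) then f x
  else \sum_(p \in setT) wt x p ^+ 2 *: f (g (node p)).

Lemma extension_on x : A x -> extension x = f x.
Proof. by rewrite /extension; case: pselect. Qed.

Lemma extension_window N x : ~ A x -> window_fits N (ln (r x)) x ->
  extension x = \sum_(p <- window n N) wt x p ^+ 2 *: f (g (node p)).
Proof.
move=> nAx xN; rewrite /extension; case: pselect => //= _.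
rewrite (fsbigE (window n N)) ?window_uniq//.
  by apply: eq_bigl => p; rewrite in_setT.
move=> p _; apply: contraNeq => w0; apply: weight_window xN _.
by apply: contraNneq w0; rewrite -/(wt x p) => ->; rewrite expr0n scale0r.
Qed.

(** A nonzero amplitude forces the mesh [expR p.1] of the grid to be at most
    [e] times the distance to the set, and the node to be within one mesh. *)
Lemma node_near x p : 0 < r x -> wt x p != 0 -> `|x - node p| <= e * r x.
Proof.
move=> r0; rewrite mulf_eq0 negb_or => /andP[/bump_lt1 lk wp].
have {}wp i : bump (x 0 i / expR p.1%:~R - (p.2 i)%:~R) != 0.
  by move/prodf_neq0: wp; exact.
have s_e : expR p.1%:~R <= e * r x.
  have rE : expR (ln (r x)) = r x by rewrite lnK ?posrE.
  rewrite /e -rE -expRD ler_expR.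
  by move: lk; rewrite ltr_norml => /andP[]; lra.
apply: le_trans s_e; have s0 := expR_gt0 (p.1%:~R : R).
apply/rV_norm_leP => [|i]; first exact: ltW.
have /bump_lt1 := wp i; set s := expR _ in s0 *.
rewrite !mxE -/s => xi.
have -> : x 0 i - s * (p.2 i)%:~R = (x 0 i / s - (p.2 i)%:~R) * s by field; lra.
by rewrite normrM (gtr0_norm s0); apply: ler_piMl; exact: ltW.
Qed.

Lemma anchor_near x p : 0 < r x -> wt x p != 0 ->
  `|x - g (node p)| <= (3 * e + 2) * r x.
Proof.
move=> r0 /(node_near r0) xp.
have h1 := gP (node p); have h2 := gap_lip A0 (node p) x.
have h3 := ler_distD (node p) x (g (node p)).
rewrite (distrC (node p) x) in h2.
by rewrite -/r in h1 h2; lra.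
Qed.

(** The coefficients have zero sum, so any reference value [z] can be subtracted
    from the vectors: only the oscillation of [f] near the point matters. *)
Lemma sum_scale_near N x (z : Z) (D : R) (c : node_index n -> R) :
  (forall p, c p != 0 -> `|f (g (node p)) - z| <= D) ->
  \sum_(p <- window n N) c p = 0 ->
  `|\sum_(p <- window n N) c p *: f (g (node p))| <=
    D * \sum_(p <- window n N) `|c p|.
Proof.
move=> cD c0.
have -> : \sum_(p <- window n N) c p *: f (g (node p)) =
    \sum_(p <- window n N) c p *: (f (g (node p)) - z).
  under [RHS]eq_bigr do rewrite scalerBr.
  by rewrite sumrB -scaler_suml c0 scale0r subr0.
apply: (le_trans (ler_norm_sum _ _ _)); rewrite mulr_sumr.
apply: ler_sum => p _; rewrite normrZ mulrC.
have [->|/cD h] := eqVneq (c p) 0; first by rewrite normr0 !mulr0.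
exact: ler_wpM2r.
Qed.

Lemma extension_near x : `|extension x - f (g x)| <= K * (3 * e + 4) * r x.
Proof.
have e2 := expR1_ge2 R; rewrite -/e in e2.
have [Ax|nAx] := pselect (A x).
  rewrite extension_on//; apply: (le_trans (fK Ax (gA x))).
  rewrite rV_mdistE -mulrA ler_wpM2l//; apply: (le_trans (gP x)).
  by rewrite /r gap_eq0// !mulr0.
have r0 := gap_gt0 A0 Acl nAx.
have [N /(_ N (leqnn N)) xN] := window_fits_ex (ln (r x)) x.
rewrite (extension_window nAx xN).
have S1 := sum_weight_sqr xN.
have -> : f (g x) = \sum_(p <- window n N) wt x p ^+ 2 *: f (g x).
  by rewrite -scaler_suml S1 scale1r.
rewrite -sumrB; under eq_bigr do rewrite -scalerBr.
apply: (le_trans (ler_norm_sum _ _ _)).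
have -> : K * (3 * e + 4) * r x =
    \sum_(p <- window n N) wt x p ^+ 2 * (K * (3 * e + 4) * r x).
  by rewrite -mulr_suml S1 mul1r.
apply: ler_sum => p _; rewrite normrZ ger0_norm ?sqr_ge0// -/(wt x p).
have [->|w0] := eqVneq (wt x p) 0; first by rewrite expr0n !mul0r.
rewrite ler_wpM2l ?sqr_ge0//; apply: (le_trans (fK (gA _) (gA _))).
rewrite rV_mdistE -mulrA ler_wpM2l//.
have := anchor_near r0 w0; have := gP x; rewrite -/r => h1 h2.
have := ler_distD x (g (node p)) (g x); rewrite (distrC (g _) x); lra.
Qed.

(** Points much closer to each other than to the set: the scales, hence the
    nodes in use, are comparable at [x] and [y], and the variation of the
    weights is estimated by [sum_sqrB_le] and [weight_corr_ge]. *)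
Lemma extension_lip_near x y : 0 < r x -> r y <= r x -> `|x - y| < r x / 2 ->
  `|extension x - extension y| <=
    27 * e * (3 * e + 5) * Num.sqrt n%:R * K * `|x - y|.
Proof.
have e2 := expR1_ge2 R; rewrite -/e in e2.
move=> r0 ryx xy.
have h1 := gap_lip A0 x y; have h2 := gap_lip A0 y x.
rewrite -/r (distrC y x) in h1 h2.
have ry : r x / 2 <= r y by lra.
have nAx : ~ A x by move=> /(gap_eq0 A0); rewrite -/r; lra.
have nAy : ~ A y by move=> /(gap_eq0 A0); rewrite -/r; lra.
have [-> |xNy] := eqVneq x y; first by rewrite !subrr !normr0 mulr0.
have d0 : 0 < `|x - y| by rewrite normr_gt0 subr_eq0.
set d := `|x - y| in d0 xy h1 h2 *.
have [N1 N1P] := window_fits_ex (ln (r x)) x; have [N2 N2P] := window_fits_ex (ln (r y)) y.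
pose N := maxn N1 N2.
have xN : window_fits N (ln (r x)) x by apply: N1P; rewrite leq_maxl.
have yN : window_fits N (ln (r y)) y by apply: N2P; rewrite leq_maxr.
have S0 : 0 < Num.sqrt n%:R :> R by rewrite sqrtr_gt0 ltr0n.
have SS : Num.sqrt n%:R ^+ 2 = n%:R :> R by rewrite sqr_sqrtr ?ler0n.
have n1 : 1 <= n%:R :> R by rewrite ler1n.
set S := Num.sqrt n%:R in S0 SS *.
(* With B = n (e d / r) ^ 2, the loss 8 ((2 d / r) ^ 2 + B) is at most 16 B, and
   16 <= 81 / 2. *)
pose q := 9 * e * S * d / r x.
have q0 : 0 < q by rewrite divr_gt0// !mulr_gt0//; lra.
pose t := d / r x.
have t0 : 0 < t by rewrite divr_gt0.
have TV : \sum_(p <- window n N) `|wt x p ^+ 2 - wt y p ^+ 2| <= 3 * q.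
  apply: sum_sqrB_le => //; [exact: sum_weight_sqr|exact: sum_weight_sqr|].
  apply: le_trans (weight_corr_ge (B := n%:R * (e * t) ^+ 2) xN yN _).
    have : (ln (r x) - ln (r y)) ^+ 2 <= (2 * t) ^+ 2.
      have t20 : 0 <= 2 * t by lra.
      rewrite -[leLHS]real_normK ?num_real// ler_sqr ?nnegrE//.
      apply: (le_trans (ln_dist_le r0 ry)); rewrite /t mulrA.
      rewrite ler_pM2r ?invr_gt0// ler_pM2l//.
      by rewrite ler_norml; apply/andP; split; lra.
    have -> : q ^+ 2 = 81 * (S ^+ 2 * (e * t) ^+ 2) by rewrite /q /t; ring.
    rewrite SS.
    have h1' : (e * t) ^+ 2 <= n%:R * (e * t) ^+ 2 by rewrite ler_peMl ?sqr_ge0.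
    have : (2 * t) ^+ 2 <= (e * t) ^+ 2.
      have et : 2 * t <= e * t by rewrite ler_wpM2r// ltW.
      by rewrite ler_sqr ?nnegrE//; lra.
    by have := sqr_ge0 (ln (r x) - ln (r y)); lra.
  move=> k lk; set s := expR k%:~R.
  have s0 : 0 < s by exact: expR_gt0.
  have rs : r x <= e * s.
    have rE : expR (ln (r x)) = r x by rewrite lnK ?posrE.
    rewrite -rE -expRD ler_expR.
    by move: lk; rewrite ltr_norml => /andP[]; lra.
  have -> : n%:R * (e * t) ^+ 2 = \sum_(i < n) (e * t) ^+ 2.
    by rewrite sumr_const card_ord mulr_natl.
  apply: ler_sum => i _; rewrite -[leLHS]real_normK ?num_real//.
  have et0 : 0 <= e * t by apply: mulr_ge0; lra.
  rewrite ler_sqr ?nnegrE// -mulrBl normrM (gtr0_norm (x := s^-1)) ?invr_gt0//.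
  have xyi : `|x 0 i - y 0 i| <= d by have := rV_norm_coord (x - y) i; rewrite !mxE.
  apply: (@le_trans _ _ (d / s)); first by rewrite ler_wpM2r ?invr_ge0 ?(ltW s0).
  rewrite ler_pdivrMr//; have -> : e * t * s = d * (e * s / r x) by rewrite /t; ring.
  by rewrite ler_peMr ?(ltW d0)// ler_pdivlMr// mul1r.
rewrite (extension_window nAx xN) (extension_window nAy yN) -sumrB.
under eq_bigr do rewrite -scalerBl.
apply: le_trans (sum_scale_near x (z := f (g x)) (D := K * ((3 * e + 5) * r x)) _ _) _.
- move=> p cp.
  apply: (le_trans (fK (gA _) (gA _))); rewrite rV_mdistE ler_wpM2l//.
  have gx := gP x; rewrite -/r in gx.
  have := ler_distD x (g (node p)) (g x); rewrite (distrC (g (node p)) x).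
  have [wx|wx] := eqVneq (wt x p) 0; last by have := anchor_near r0 wx; lra.
  have wy : wt y p != 0 by apply: contraNneq cp => wy; rewrite wx wy subrr.
  have := anchor_near (lt_le_trans _ ry) wy; rewrite divr_gt0// => /(_ isT).
  have := ler_distD y x (g (node p)); rewrite -/d.
  have : (3 * e + 2) * r y <= (3 * e + 2) * r x by rewrite ler_wpM2l//; lra.
  lra.
- by rewrite sumrB !sum_weight_sqr// subrr.
apply: (@le_trans _ _ (K * ((3 * e + 5) * r x) * (3 * q))).
  by rewrite ler_wpM2l// !mulr_ge0//; lra.
by rewrite /q le_eqVlt; apply/orP; left; apply/eqP; field; lra.
Qed.

(** Points far apart relative to their distance to the set are compared through
    the nearby points [g x] and [g y] of the set. *)
Lemma extension_lip x y :
  `|extension x - extension y| <=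
    27 * e * (3 * e + 5) * Num.sqrt n%:R * K * `|x - y|.
Proof.
have e2 := expR1_ge2 R; rewrite -/e in e2.
wlog ryx : x y / r y <= r x.
  move=> h; have [/h//|/ltW/h] := leP (r y) (r x).
  by rewrite distrC [`|y - x|]distrC.
have C1 : 12 * e + 25 <= 27 * e * (3 * e + 5) * Num.sqrt n%:R.
  have S1 : 1 <= Num.sqrt n%:R :> R by rewrite -{1}sqrtr1 ler_sqrt ?ler1n ?ler0n.
  by apply: (@le_trans _ _ (27 * e * (3 * e + 5))); [nra|rewrite ler_peMr//; nra].
have d0 := normr_ge0 (x - y).
have [far|near] := leP (r x / 2) `|x - y|; last first.
  have [r0|r0] := ltP 0 (r x); first exact: extension_lip_near.
  by have := gap_ge0 A0 x; rewrite -/r; lra.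
apply: (@le_trans _ _ ((12 * e + 25) * (K * `|x - y|))); last first.
  by rewrite -mulrA ler_wpM2r// mulr_ge0.
have nx := extension_near x; have ny := extension_near y.
have gxy : `|f (g x) - f (g y)| <= K * (9 * `|x - y|).
  apply: (le_trans (fK (gA _) (gA _))); rewrite rV_mdistE ler_wpM2l//.
  have := gP x; have := gP y; rewrite -/r => h1 h2.
  have := ler_distD x (g x) (g y); have := ler_distD y x (g y).
  by rewrite (distrC (g x) x); lra.
have Kr : K * (3 * e + 4) * r y <= K * (3 * e + 4) * r x.
  by rewrite ler_wpM2l// mulr_ge0//; lra.
have Krd : K * (3 * e + 4) * r x <= K * (3 * e + 4) * (2 * `|x - y|).
  by rewrite ler_wpM2l ?mulr_ge0//; lra.
have -> : extension x - extension y = (extension x - f (g x))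
   + (f (g x) - f (g y)) + (f (g y) - extension y) by rewrite !subrKA.
have t1 := ler_normD (extension x - f (g x) + (f (g x) - f (g y))) (f (g y) - extension y).
have t2 := ler_normD (extension x - f (g x)) (f (g x) - f (g y)).
rewrite (distrC _ (extension y)) in t1; lra.
Qed.

End Extension.

Lemma lip_ext_modulus_le (R : realType) (n : nat) : (0 < n)%N ->
  (lip_ext_modulus 'rV[R]_n <=
    (27 * expR 1 * (3 * expR 1 + 5) * Num.sqrt n%:R)%:E)%E.
Proof.
move=> n0; have e2 := expR1_ge2 R.
set C := 27 * expR 1 * (3 * expR 1 + 5).
have C1 : 1 <= C by rewrite /C; nra.
have S1 : 1 <= Num.sqrt n%:R :> R by rewrite -{1}sqrtr1 ler_sqrt ?ler1n ?ler0n.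
apply: ereal_inf_lbound; split; first by rewrite lee_fin; nra.
move=> A Z f A0 /lip_const_fin[K [K0 -> fK]].
have [f' [f'f f'K]] := lip_closure K0 fK.
have clA0 : closure A !=set0 by case: A0 => a Aa; exists a; exact: subset_closure.
have [g gP] := choice (near_point clA0 (@closed_closure _ A)).
exists (extension (closure A) f' g); split=> [x Ax|].
  by rewrite extension_on ?f'f//; exact: subset_closure.
rewrite -EFinM; apply: lip_const_le.
  by rewrite !mulr_ge0//; lra.
move=> x y _ _; rewrite rV_mdistE; apply: extension_lip => //.
- exact: closed_closure.
- by move=> z; case: (gP z).
- by move=> z; case: (gP z).
Qed.

(** * A norm adapted to a projection *)

(** A copy of the row vectors carrying another norm: multiplication by [Q]
    is a contraction from it to the supremum norm, and the two norms agree on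
    the vectors fixed by [Q]. *)
Definition split_space (R : realType) (m : nat) (Q : 'M[R]_m) : Type := 'rV[R]_m.

Section SplitSpace.
Variables (R : realType) (m : nat) (Q : 'M[R]_m).
Local Notation Z := (split_space Q).

HB.instance Definition _ := GRing.Lmodule.copy Z 'rV[R]_m.

Definition split_norm (u : Z) : R :=
  `|(u : 'rV[R]_m) *m Q| + `|(u : 'rV[R]_m) - (u : 'rV[R]_m) *m Q|.

Lemma split_normD (u v : Z) : split_norm (u + v) <= split_norm u + split_norm v.
Proof.
rewrite /split_norm mulmxDl opprD addrACA [leRHS]addrACA lerD ?ler_normD//.
Qed.

Lemma split_normZ (l : R) (u : Z) : split_norm (l *: u) = `|l| * split_norm u.
Proof. by rewrite /split_norm -scalemxAl -scalerBr !normrZ mulrDr. Qed.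

Lemma norm_le_split (u : Z) : `|u : 'rV[R]_m| <= split_norm u.
Proof.
by rewrite -{1}[u : 'rV[R]_m](subrKC ((u : 'rV[R]_m) *m Q)) ler_normD.
Qed.

Lemma split_norm_eq0 (u : Z) : split_norm u = 0 -> u = 0.
Proof.
move=> u0; apply/eqP; rewrite -(normr_eq0 (u : 'rV[R]_m)) eq_le normr_ge0 andbT.
by rewrite -u0 norm_le_split.
Qed.

HB.instance Definition _ := @Lmodule_isNormed.Build R Z split_norm
  split_normD split_normZ split_norm_eq0.

Lemma split_ballE (z w : Z) e : ball z e w = (split_norm (z - w) < e) :> Prop.
Proof. by rewrite -ball_normE. Qed.

(** The norm is equivalent to the supremum norm. *)
Lemma split_complete (F : set_system Z) : ProperFilter F -> cauchy F -> cvg F.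
Proof.
move=> FF cF; pose G : set_system 'rV[R]_m := F.
have GF : ProperFilter G by exact: FF.
have cG : cauchy G.
  apply: cauchy_exP => e e0.
  have [z zF] := (cauchyP _).1 cF e e0.
  exists (z : 'rV[R]_m); apply: filterS zF => w.
  rewrite split_ballE -ball_normE /= => zw.
  exact: le_lt_trans (norm_le_split (z - w)) zw.
have /cvg_ex[/= l Gl] : cvg G by exact: cauchy_cvg.
apply/cvg_ex; exists (l : Z) => W /nbhs_ballP[e /= e0 lW].
have [B B0 QB] := mulmx_norm_le Q.
pose d := e / (2 * B + 2).
have B2 : 0 < 2 * B + 2 by lra.
have d0 : 0 < d by rewrite divr_gt0.
apply: filterS (Gl _ (nbhsx_ballx l d d0)) => w lw; apply: lW.
rewrite -ball_normE /= in lw; rewrite /= split_ballE.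
have h := QB (l - w); rewrite /split_norm.
have h2 := ler_normB (l - w) ((l - w) *m Q).
have de : (2 * B + 2) * d = e by rewrite /d; field; lra.
have : B * `|l - w| <= B * d by rewrite ler_wpM2l// ltW.
rewrite -[X in `|X *m _| + _]/(l - w) -[X in _ + `|X - _|]/(l - w).
lra.
Qed.

HB.instance Definition _ := Uniform_isComplete.Build Z split_complete.

End SplitSpace.

(** * Linearization of Lipschitz retractions by Banach limits *)

Section BanachLimit.
Variable R : realType.
Implicit Types u v : nat -> R.

Definition seq_bounded u := exists B, forall t, `|u t| <= B.

Definition is_banach_limit (L : (nat -> R) -> R) := [/\
  forall u v, seq_bounded u -> seq_bounded v -> L (fun t => u t + v t) = L u + L v,
  forall c u, seq_bounded u -> L (fun t => c * u t) = c * L u,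
  forall u B, (forall t, `|u t| <= B) -> `|L u| <= B,
  forall c, L (fun=> c) = c &
  forall u, seq_bounded u -> L (fun t => u t.+1) = L u].

Let cesaro u (t : nat) := (\sum_(i < t.+1) u i) / t.+1%:R.

Lemma cesaro_le u B t : (forall t, `|u t| <= B) -> `|cesaro u t| <= B.
Proof.
move=> uB; rewrite normrM normfV (ger0_norm (ler0n R _)) ler_pdivrMr ?ltr0n//.
apply: (le_trans (ler_norm_sum _ _ _)).
apply: (@le_trans _ _ (\sum_(i < t.+1) B)); first exact: ler_sum.
by rewrite sumr_const card_ord mulr_natr.
Qed.

(** Limits of Cesaro means along an ultrafilter: averaging makes a shift of the
    sequence negligible, and the ultrafilter makes all bounded sequences
    converge. *)
Lemma banach_limit_ex : exists L, is_banach_limit L.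
Proof.
have [U [UU sU]] := @ultraFilterLemma nat \oo _.
have UP : ProperFilter U by exact: ultra_proper.
have cvgU (m : nat -> R) B : (forall t, `|m t| <= B) -> cvg (m @ U).
  move=> mB; have mU : (m @ U) `[- B, B]%classic.
    apply: (@filterE _ U) => t; rewrite /= in_itv/= -ler_norml; exact: mB.
  have [p [_ mp]] := segment_compact _ mU.
  apply/cvg_ex; exists p => W pW.
  have [//|UC] := in_ultra_setVsetC (m @^-1` W) UU.
  have [x [nWx Wx]] := mp (~` W) W UC pW.
  by [].
pose L u := lim (cesaro u @ U).
have Lcvg u : seq_bounded u -> cesaro u @ U --> L u.
  by move=> [B uB]; apply: (@cvgU _ B) => t; exact: cesaro_le.
have Leq u l : cesaro u @ U --> l -> L u = l by move=> ?; exact/cvg_lim.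
have oo (w : nat -> R) l : w @ \oo --> l -> w @ U --> l.
  by move=> wl W /wl; exact: sU.
exists L; split.
- move=> u v ub vb; apply: Leq.
  have -> : cesaro (fun t => u t + v t) = cesaro u \+ cesaro v.
    by apply/funext => t; rewrite /cesaro big_split mulrDl.
  by apply: cvgD; exact: Lcvg.
- move=> c u ub; apply: Leq.
  have -> : cesaro (fun t => c * u t) = (fun t => c * cesaro u t).
    by apply/funext => t; rewrite /cesaro -mulr_sumr mulrA.
  by apply: cvgMr; exact: Lcvg.
- move=> u B uB.
  have /Lcvg Lu : seq_bounded u by exists B.
  have /cvg_norm nLu := Lu.
  apply: (closed_cvg (fun x : R => x <= B) _ _ _ nLu).
  + exact: closed_le.
  + by apply: filterE => t; exact: cesaro_le.
- move=> c; apply: Leq.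
  have -> : cesaro (fun=> c) = (fun=> c).
    by apply/funext => t; rewrite /cesaro sumr_const card_ord -[c *+ _]mulr_natr mulfK// pnatr_eq0.
  exact: cvg_cst.
- move=> u [B uB]; apply: Leq.
  have -> : cesaro (fun t => u t.+1) = (fun t => cesaro u t + (u t.+1 - u 0) / t.+1%:R).
    apply/funext => t; rewrite /cesaro -mulrDl; congr (_ / _).
    rewrite [in RHS]big_ord_recl [LHS]big_ord_recr /=; ring.
  rewrite -[L u]addr0; apply: cvgD; first by apply: Lcvg; exists B.
  apply: oo; apply/cvgrPdist_le => e e0; near=> t.
  have B0 : 0 <= B by apply: le_trans (uB 0).
  have tB : 2 * B / e <= t.+1%:R.
    apply: (@le_trans _ _ t%:R); last by rewrite ler_nat.
    by near: t; exact: nbhs_infty_ger.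
  rewrite sub0r normrN normrM normfV (ger0_norm (ler0n R _)) ler_pdivrMr ?ltr0n//.
  have := ler_normB (u t.+1) (u 0); have := uB t.+1; have := uB 0.
  by rewrite ler_pdivrMr// mulrC in tB; lra.
Unshelve. all: by end_near. Qed.

End BanachLimit.

Section DirectionalMeans.
Variables (R : realType) (V : zmodType) (L : (nat -> R) -> R).
Hypothesis hL : is_banach_limit L.
Implicit Types (phi psi : V -> R) (v w x : V) (s : seq V).

Definition dirmean v phi x := L (fun t => phi (x + v *+ t)).

(** Averages in several directions, one after the other. Averaging in a further
    direction preserves invariance under the earlier ones ([iter_mean_shift]),
    so that the result is invariant under all of them. *)
Definition iter_mean s phi := foldr dirmean phi s.

Lemma iter_mean_shift s phi w :
  iter_mean s (fun x => phi (x + w)) = fun x => iter_mean s phi (x + w).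
Proof.
elim: s => //= v s ->; apply/funext => x; congr L; apply/funext => t.
by rewrite addrAC.
Qed.

Lemma iter_mean_le s phi B : (forall x, `|phi x| <= B) -> forall x, `|iter_mean s phi x| <= B.
Proof. by case: hL => _ _ Lle _ _ phiB; elim: s => //= v s IHs x; apply: Lle. Qed.

Lemma iter_mean_cst s c : iter_mean s (fun=> c) = fun=> c.
Proof.
by case: hL => _ _ _ Lc _; elim: s => //= v s ->; apply/funext => x; exact: Lc.
Qed.

Section Along.
Variable E : set V.
Hypotheses (E0 : E 0) (ED : forall v w, E v -> E w -> E (v + w)).

(** Boundedness on each coset of [E], without uniformity: the displacement
    [G z - z] of a retraction onto [E] has this property, and is unbounded in
    general. *)
Definition bounded_along phi :=
  forall x, exists B, forall e, E e -> `|phi (x + e)| <= B.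

Lemma mulrn_along v t : E v -> E (v *+ t).
Proof. by move=> Ev; elim: t => // t IHt; rewrite mulrS; exact: ED. Qed.

Lemma bounded_along_seq phi v x : E v -> bounded_along phi ->
  seq_bounded (fun t => phi (x + v *+ t)).
Proof. by move=> Ev /(_ x)[B phiB]; exists B => t; apply/phiB/mulrn_along. Qed.

Lemma bounded_along_dirmean v phi : E v -> bounded_along phi ->
  bounded_along (dirmean v phi).
Proof.
case: hL => _ _ Lle _ _ Ev phib x; have [B phiB] := phib x.
exists B => e Ee; apply: Lle => t; rewrite -addrA; apply: phiB.
by apply: ED => //; exact: mulrn_along.
Qed.

Lemma bounded_along_mean s phi : {in s, forall v, E v} -> bounded_along phi ->
  bounded_along (iter_mean s phi).
Proof.
elim: s => //= v s IHs Es phib; apply: bounded_along_dirmean.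
  by apply: Es; rewrite mem_head.
by apply: IHs => // w ws; apply: Es; rewrite inE ws orbT.
Qed.

Lemma iter_meanD s phi psi : {in s, forall v, E v} ->
  bounded_along phi -> bounded_along psi ->
  iter_mean s (fun x => phi x + psi x) = fun x => iter_mean s phi x + iter_mean s psi x.
Proof.
move=> + phib psib; case: hL => LD _ _ _ _; elim: s => //= v s IHs Es.
have Ev : E v by apply: Es; rewrite mem_head.
have {}Es : {in s, forall v, E v} by move=> w ws; apply: Es; rewrite inE ws orbT.
rewrite IHs//; apply/funext => x.
by apply: LD; apply: bounded_along_seq => //; exact: bounded_along_mean.
Qed.

Lemma iter_meanZ s c phi : {in s, forall v, E v} -> bounded_along phi ->
  iter_mean s (fun x => c * phi x) = fun x => c * iter_mean s phi x.
Proof.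
move=> + phib; case: hL => _ LZ _ _ _; elim: s => //= v s IHs Es.
have Ev : E v by apply: Es; rewrite mem_head.
have {}Es : {in s, forall v, E v} by move=> w ws; apply: Es; rewrite inE ws orbT.
rewrite IHs//; apply/funext => x.
by apply: LZ; apply: bounded_along_seq => //; exact: bounded_along_mean.
Qed.

Lemma iter_mean_invariant s phi v x : {in s, forall v, E v} -> bounded_along phi ->
  v \in s -> iter_mean s phi (x + v) = iter_mean s phi x.
Proof.
move=> + phib; case: hL => _ _ _ _ LS; elim: s x => //= w s IHs x Es.
have Ew : E w by apply: Es; rewrite mem_head.
have {}Es : {in s, forall v, E v} by move=> u us; apply: Es; rewrite inE us orbT.
rewrite inE => /orP[/eqP->|vs].
  rewrite /dirmean -[RHS]LS; last first.
    by apply: bounded_along_seq => //; exact: bounded_along_mean.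
  by congr L; apply/funext => t; rewrite mulrS addrA.
by rewrite /dirmean; congr L; apply/funext => t; rewrite addrAC IHs.
Qed.

End Along.

End DirectionalMeans.

Definition integral_row (R : realType) (m : nat) (u : 'rV[R]_m) :=
  exists c : 'I_m -> int, forall i, u 0 i = (c i)%:~R.

Section Linearize.
Variables (R : realType) (m : nat) (G : 'rV[R]_m -> 'rV[R]_m) (K : R).
Variables (E : set 'rV[R]_m) (vs : seq 'rV[R]_m).
Hypothesis GK : forall x y, `|G x - G y| <= K * `|x - y|.
Hypotheses (E0 : E 0) (ED : forall v w, E v -> E w -> E (v + w)).
Hypotheses (GE : forall e, E e -> G e = e) (vsE : {in vs, forall v, E v}).
Variables (L : (nat -> R) -> R).
Hypothesis hL : is_banach_limit L.
Implicit Types u w x z : 'rV[R]_m.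

Let es : seq 'rV[R]_m := [seq delta_mx 0 i | i <- enum 'I_m].
(* The differences of G are bounded, while G itself is not. *)
Let diff u (j : 'I_m) z := G (z + u) 0 j - G z 0 j.
Let D u : 'rV[R]_m := \row_j iter_mean L es (iter_mean L vs (diff u j)) 0.
Let T : set 'rV[R]_m := setT.
Let T0 : T 0. Proof. by []. Qed.
Let TD (v w : 'rV[R]_m) : T v -> T w -> T (v + w). Proof. by []. Qed.
Let esT : {in es, forall v, T v}. Proof. by []. Qed.
Let vsT : {in vs, forall v, T v}. Proof. by []. Qed.

Lemma diff_le u j z : `|diff u j z| <= K * `|u|.
Proof.
have := rV_norm_coord (G (z + u) - G z) j; rewrite !mxE => h.
by apply: (le_trans h); apply: (le_trans (GK _ _)); rewrite addrC addKr.
Qed.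

Lemma diff_bounded u j : bounded_along T (diff u j).
Proof. by move=> x; exists (K * `|u|) => e _; exact: diff_le. Qed.

Let inv w := forall phi x, bounded_along T phi -> iter_mean L es phi (x + w) = iter_mean L es phi x.

(** Additivity of the averaged difference, from
    [G (z + u + w) - G z = (G (z + w + u) - G (z + w)) + (G (z + w) - G z)]
    and invariance of the mean under translation by [w]. *)
Lemma D_add u w : inv w -> D (u + w) = D u + D w.
Proof.
move=> invw; apply/rowP => j; rewrite !mxE.
have -> : diff (u + w) j = fun z => diff u j (z + w) + diff w j z.
  by apply/funext => z; rewrite /diff (addrC u) addrA subrKA.
have du := diff_bounded u j; have dw := diff_bounded w j.
have duw : bounded_along T (fun z => diff u j (z + w)).
  by move=> x; exists (K * `|u|) => e _; exact: diff_le.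
have M phi : bounded_along T phi -> bounded_along T (iter_mean L vs phi).
  exact: bounded_along_mean.
rewrite (iter_meanD hL T0 TD)// (iter_meanD hL T0 TD)//; [|exact: M|exact: M].
by rewrite !iter_mean_shift invw//; exact: M.
Qed.

Let P : 'M[R]_m := \matrix_(i, j) D (delta_mx 0 i) 0 j.
(* The vectors on which the averaged difference is the linear map P. *)
Let lattice w := inv w /\ D w = w *m P.

Lemma lattice_delta i : lattice (delta_mx 0 i).
Proof.
split=> [phi x phib|].
  by apply: (iter_mean_invariant hL T0 TD) => //; apply: map_f; rewrite mem_enum.
by rewrite -rowE; apply/rowP => j; rewrite !mxE.
Qed.

Lemma lattice_add u w : lattice u -> lattice w -> lattice (u + w).
Proof.
move=> [invu Du] [invw Dw]; split=> [phi x phib|]; first by rewrite addrA invw// invu.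
by rewrite D_add// Du Dw mulmxDl.
Qed.

Lemma lattice_0 : lattice 0.
Proof.
split=> [phi x phib|]; first by rewrite addr0.
apply/rowP => j; rewrite mul0mx !mxE.
have -> : diff 0 j = fun=> 0 by apply/funext => z; rewrite /diff addr0 subrr.
by rewrite !(iter_mean_cst hL).
Qed.

Lemma lattice_opp w : lattice w -> lattice (- w).
Proof.
move=> [invw Dw].
have invNw : inv (- w) by move=> phi x phib; rewrite -(invw phi (x - w))// subrK.
split=> //; rewrite mulNmx -Dw; apply/eqP; rewrite -addr_eq0 addrC -D_add//.
by rewrite subrr lattice_0.2 mul0mx.
Qed.

Lemma lattice_mulrz w (c : int) : lattice w -> lattice (w *~ c).
Proof.
move=> lw; have nat_mul k : lattice (w *+ k).
  by elim: k => [|k IHk]; [exact: lattice_0|rewrite mulrS; exact: lattice_add].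
by case: c => k; [exact: nat_mul|apply: lattice_opp; exact: nat_mul].
Qed.

Lemma lattice_integral u : integral_row u -> lattice u.
Proof.
move=> [c uc]; rewrite (row_sum_delta u).
elim/big_ind: _ => [||i _]; [exact: lattice_0|exact: lattice_add|].
by rewrite uc scaler_int; apply: lattice_mulrz; exact: lattice_delta.
Qed.

Let Lam phi := iter_mean L es (iter_mean L vs phi) 0.

Lemma Lam_sum (I : Type) (s : seq I) (c : I -> R) (phi : I -> 'rV[R]_m -> R) :
  (forall i, bounded_along T (phi i)) ->
  Lam (fun z => \sum_(i <- s) c i * phi i z) = \sum_(i <- s) c i * Lam (phi i).
Proof.
move=> phib; have M psi : bounded_along T psi -> bounded_along T (iter_mean L vs psi).
  exact: bounded_along_mean.
have Zb i : bounded_along T (fun z => c i * phi i z).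
  move=> x; have [B phiB] := phib i x; exists (`|c i| * B) => e Te.
  by rewrite normrM ler_wpM2l// phiB.
elim: s => [|i s IHs].
  rewrite big_nil /Lam; under eq_fun do rewrite big_nil.
  by rewrite !(iter_mean_cst hL).
have Sb : bounded_along T (fun z => \sum_(i <- s) c i * phi i z).
  elim: s {IHs} => [|k s IHs] x.
    by exists 0 => e _; rewrite big_nil normr0.
  have [B1 h1] := Zb k x; have [B2 h2] := IHs x.
  exists (B1 + B2) => e Te; rewrite big_cons.
  by apply: (le_trans (ler_normD _ _)); apply: lerD; [exact: h1|exact: h2].
rewrite big_cons -IHs /Lam; under eq_fun do rewrite big_cons.
rewrite (iter_meanD hL T0 TD)// (iter_meanD hL T0 TD)//; [|exact: M|exact: M].
by rewrite (iter_meanZ hL T0 TD)// (iter_meanZ hL T0 TD)//; exact: M.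
Qed.

(** Write [G z = z + F z]. Since [G] is the identity on [E], the function [F] is
    bounded along [E]; its mean is invariant under translation by [v], so the
    difference of [F] averages to zero. *)
Lemma diff_along v j : v \in vs -> iter_mean L vs (diff v j) = fun=> v 0 j.
Proof.
move=> vvs; pose F z := G z 0 j - z 0 j.
have Fb : bounded_along E F.
  move=> x; exists (K * `|x| + `|x|) => e Ee; rewrite /F mxE.
  have -> : G (x + e) 0 j - (x 0 j + e 0 j) = (G (x + e) - G e) 0 j - x 0 j.
    by rewrite !mxE (GE Ee); ring.
  apply: (le_trans (ler_normB _ _)); apply: lerD; last exact: rV_norm_coord.
  apply: (le_trans (rV_norm_coord _ _)); apply: (le_trans (GK _ _)).
  by rewrite addrK.
have Fvb : bounded_along E (fun z => F (z + v)).
  move=> x; have [B FB] := Fb x; exists B => e Ee.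
  by rewrite -addrA; apply: FB; apply: ED => //; exact: vsE.
have NFb : bounded_along E (fun z => (-1) * F z).
  by move=> x; have [B FB] := Fb x; exists B => e Ee; rewrite mulN1r normrN FB.
have cb : bounded_along E (fun=> v 0 j) by move=> x; exists `|v 0 j|.
have FNb : bounded_along E (fun z => F (z + v) + (-1) * F z).
  move=> x; have [B1 h1] := Fvb x; have [B2 h2] := NFb x.
  exists (B1 + B2) => e Te.
  by apply: (le_trans (ler_normD _ _)); apply: lerD; [exact: h1|exact: h2].
have -> : diff v j = fun z => F (z + v) + (-1) * F z + v 0 j.
  by apply/funext => z; rewrite /diff /F mxE; ring.
rewrite (iter_meanD hL E0 ED)// (iter_meanD hL E0 ED)// (iter_meanZ hL E0 ED)// iter_mean_shift.
rewrite (iter_mean_cst hL); apply/funext => x.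
by rewrite (iter_mean_invariant hL E0 ED)// mulN1r subrr add0r.
Qed.

(** The map [u] to the average of [G (z + u) - G z] is additive on integral
    vectors; it inherits the Lipschitz bound, the vectors fixed in [E], and the
    linear relations satisfied by the values of [G]. *)
Lemma linearization : exists M : 'M[R]_m, [/\
  forall u, integral_row u -> `|u *m M| <= K * `|u|,
  forall v, v \in vs -> integral_row v -> v *m M = v &
  forall (H : 'M[R]_m) (r : R), (forall x, G x *m H = r *: G x) -> M *m H = r *: M].
Proof.
exists P; split=> [u /lattice_integral[_ <-]|v vvs /lattice_integral[_ <-]|H r GH].
- have K0 : 0 <= K * `|u| by have := GK u 0; rewrite subr0; exact: le_trans.
  apply/rV_norm_leP => // j; rewrite mxE; apply: iter_mean_le => // x.
  by apply: iter_mean_le => // y; exact: diff_le.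
- by apply/rowP => j; rewrite mxE diff_along// (iter_mean_cst hL).
- apply/matrixP => i j; rewrite !mxE.
  set u := delta_mx 0 i.
  transitivity (\sum_k H k j * Lam (diff u k)).
    by apply: eq_bigr => k _; rewrite !mxE mulrC.
  rewrite -Lam_sum; last by move=> k; exact: diff_bounded.
  transitivity (\sum_(k <- [:: j]) r * Lam (diff u k)); last by rewrite big_seq1.
  rewrite -Lam_sum; last by move=> k; exact: diff_bounded.
  congr Lam; apply/funext => z; rewrite big_seq1 /diff.
  have GHj x : \sum_k G x 0 k * H k j = r * G x 0 j.
    by have /rowP/(_ j) := GH x; rewrite !mxE.
  rewrite mulrBr -!GHj -sumrB; apply: eq_bigr => k _; ring.
Qed.

End Linearize.

(** * Hadamard matrices and the lower bound *)

(** The order [2 ^ k], in the form that block matrices of equal blocks produce. *)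
Fixpoint hdim k : nat := if k is k'.+1 then hdim k' + hdim k' else 1.

Lemma hdimE k : hdim k = (2 ^ k)%N.
Proof. by elim: k => //= k ->; rewrite expnS mul2n addnn. Qed.

Fixpoint hadamard (R : pzRingType) k : 'M[R]_(hdim k) :=
  if k is k'.+1 return 'M[R]_(hdim k)
  then block_mx (hadamard R k') (hadamard R k') (hadamard R k') (- hadamard R k')
  else 1%:M.

Section Hadamard.
Variable R : realType.

Lemma hadamard_sqr k : hadamard R k *m hadamard R k = (2 ^+ k)%:M.
Proof.
elim: k => [|k IHk]; first by rewrite mulmx1 expr0.
rewrite /= mulmx_block !mulNmx !mulmxN IHk opprK subrr.
by rewrite exprS mulr_natl mulr2n scalar_mx_block raddfD.
Qed.

Lemma hadamard_trace k : 0 <= \tr (hadamard R k).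
Proof.
case: k => [|k] /=; first by rewrite mxtrace1.
by rewrite mxtrace_block raddfN subrr.
Qed.

Lemma hadamard_sign k i j : exists b : bool, hadamard R k i j = (-1) ^+ b.
Proof.
elim: k i j => [|k IHk] i j /=.
  by exists false; rewrite !ord1 mxE eqxx expr0.
case: (split_ordP i) => i' ->; case: (split_ordP j) => j' ->;
  have [b bE] := IHk i' j'.
- by exists b; rewrite block_mxEul.
- by exists b; rewrite block_mxEur.
- by exists b; rewrite block_mxEdl.
- by exists (~~ b); rewrite block_mxEdr mxE bE signrN.
Qed.

End Hadamard.

(** Padding with zeros is an isometry of l_infty^m into l_infty^(m + q), so a
    function on a subset of the former can be transported to the latter,
    extended there, and restricted back. *)
Lemma extendable_lshift (R : realType) (m q : nat) (L : \bar R) :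
  lip_extendable 'rV[R]_(m + q) L -> lip_extendable 'rV[R]_m L.
Proof.
move=> ext A Z f A0 /lip_const_fin[K [K0 fK fL]].
pose A' : set 'rV[R]_(m + q) := [set row_mx a 0 | a in A].
pose f' (x : 'rV[R]_(m + q)) := f (lsubmx x).
have normE (a : 'rV[R]_m) : `|row_mx a (0 : 'rV[R]_q)| = `|a|.
  apply/eqP; rewrite eq_le; apply/andP; split; apply/rV_norm_leP => // i.
    case: (split_ordP i) => i' ->; first by rewrite row_mxEl rV_norm_coord.
    by rewrite row_mxEr mxE normr0.
  by have := rV_norm_coord (row_mx a (0 : 'rV[R]_q)) (lshift q i); rewrite row_mxEl.
have distE (a b : 'rV[R]_m) :
    `|row_mx a (0 : 'rV[R]_q) - row_mx b 0| = `|a - b|.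
  by rewrite opp_row_mx add_row_mx subr0 normE.
have f'K : (lip_const A' f' <= K%:E)%E.
  apply: lip_const_le => // _ _ [a Aa <-] [b Ab <-].
  by rewrite rV_mdistE distE /f' !row_mxKl; exact: fL.
have f'0 : lip_const A' f' = K%:E.
  apply/eqP; rewrite eq_le f'K /= -fK.
  apply: le_ereal_inf_tmp => _ [K' [K'0 f'K'] <-]; apply: lip_const_le => // a b Aa Ab.
  have := f'K' _ _ (imageP _ Aa) (imageP _ Ab).
  by rewrite rV_mdistE distE /f' !row_mxKl.
have A'0 : A' !=set0 by case: A0 => a Aa; exists (row_mx a 0), a.
have [|F [Ff FL]] := ext A' Z f' A'0; first by rewrite f'0 ltry.
exists (fun x => F (row_mx x 0)); split=> [x Ax|].
  by rewrite Ff ?/f' ?row_mxKl//; exists x.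
rewrite fK -f'0; apply: le_trans FL.
apply: le_ereal_inf_tmp => _ [K' [K'0 FK'] <-]; apply: lip_const_le => // a b _ _.
by have := FK' (row_mx a 0) (row_mx b 0) I I; rewrite rV_mdistE distE.
Qed.

Section HadamardLower.
Variables (R : realType) (m r : nat) (H : 'M[R]_m).
Hypotheses (r0 : (0 < r)%N) (HH : H *m H = (r%:R ^+ 2)%:M) (Hmr : m = (r ^ 2)%N).
Hypotheses (Htr : 0 <= \tr H) (Hsign : forall i j, exists b : bool, H i j = (-1) ^+ b).

Let Q := (2 * r%:R)^-1 *: (r%:R%:M + H).
Let E : set 'rV[R]_m := [set x | x *m H = r%:R *: x].

Let rR : 0 < r%:R :> R. Proof. by rewrite ltr0n. Qed.

Lemma projection_on e : E e -> e *m Q = e.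
Proof.
move=> Ee; rewrite -scalemxAr mulmxDr mul_mx_scalar Ee -scalerDl scalerA.
by rewrite (_ : _ * _ = 1) ?scale1r//; field; exact: lt0r_neq0.
Qed.

Lemma eigen_rows : (r%:R%:M + H) *m H = r%:R *: (r%:R%:M + H).
Proof.
rewrite mulmxDl HH mul_scalar_mx scalerDr addrC; congr (_ + _).
by rewrite scale_scalar_mx -expr2.
Qed.

Lemma projection_eigen : Q *m H = r%:R *: Q.
Proof. by rewrite -scalemxAl eigen_rows /Q !scalerA mulrC. Qed.

Lemma hadamard_lower (L : R) : 0 <= L -> lip_extendable 'rV[R]_m L%:E -> r%:R / 2 <= L.
Proof.
move=> L0 ext.
pose Z : completeNormedModType R := split_space Q.
pose f (x : 'rV[R]_m) : Z := x.
have E0 : E 0 by rewrite /E /= mul0mx scaler0.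
have ED x y : E x -> E y -> E (x + y).
  by rewrite /E /= mulmxDl scalerDr => -> ->.
have EB x y : E x -> E y -> E (x - y).
  by rewrite /E /= mulmxBl scalerBr => -> ->.
have f1 : (lip_const E f <= 1%:E)%E.
  apply: lip_const_le => // x y Ex Ey; rewrite rV_mdistE mul1r.
  rewrite [X in X <= _](_ : _ = split_norm (x - y : Z))//.
  by rewrite /split_norm projection_on ?subrr ?normr0 ?addr0//; exact: EB.
have [||F [Ff FL]] := ext E Z f; first by exists 0.
  by rewrite (le_lt_trans f1)// ltry.
have FK : lip_on L setT F.
  apply: lip_on_const; apply: (le_trans FL).
  by rewrite -[leRHS]mule1; apply: lee_wpmul2l.
pose G x : 'rV[R]_m := (F x : 'rV[R]_m) *m Q.
have GK x y : `|G x - G y| <= L * `|x - y|.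
  apply: le_trans (FK x y I I).
  by rewrite /G -mulmxBl [leRHS](_ : _ = split_norm (F x - F y : Z))// lerDl.
have GE e : E e -> G e = e by move=> Ee; rewrite /G Ff// projection_on.
have GH x : G x *m H = r%:R *: G x.
  by rewrite /G -mulmxA projection_eigen -scalemxAr.
pose V := r%:R%:M + H.
pose vs : seq 'rV[R]_m := [seq row i V | i <- enum 'I_m].
have vsE : {in vs, forall v, E v}.
  by move=> _ /mapP[i _ ->]; rewrite /E /= -row_mul eigen_rows; apply/rowP => j; rewrite !mxE.
have [lim hlim] := banach_limit_ex R.
have [M [MK MV MH]] := linearization GK E0 ED GE vsE hlim.
have sgz (b : bool) : (-1) ^+ b = ((-1) ^+ b : int)%:~R :> R by rewrite rmorphXn rmorphN1.
have Hint i : integral_row (row i H).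
  have /choice[b bP] := Hsign i.
  by exists (fun j => (-1) ^+ b j) => j; rewrite !mxE bP sgz.
have Vint i : integral_row (row i V).
  have [c cP] := Hint i.
  exists (fun j => r%:Z *+ (i == j) + c j) => j; rewrite !mxE intrD -cP mxE.
  by congr (_ + _); case: (i == j); rewrite ?mulr1n ?mulr0n.
have VM : V *m M = V.
  apply/row_matrixP => i; rewrite row_mul; apply: MV => //.
  by apply: map_f; rewrite mem_enum.
have HM : \tr (H *m M) <= L * m%:R.
  have -> : L * m%:R = \sum_(i < m) L by rewrite sumr_const card_ord mulr_natr.
  apply: ler_sum => i _; apply: (le_trans (ler_norm _)).
  have := rV_norm_coord (row i H *m M) i; rewrite -row_mul mxE => h.
  apply: (le_trans h); rewrite row_mul; apply: (le_trans (MK _ (Hint i))).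
  rewrite ler_piMr//; apply/rV_norm_leP => // j; rewrite mxE.
  by have [b ->] := Hsign i j; rewrite normrX normrN1 expr1n.
(* M H = r M and the symmetry of the trace. *)
have trM : \tr (H *m M) = r%:R * \tr M by rewrite mxtrace_mulC (MH _ _ GH) mxtraceZ.
have : \tr (V *m M) = \tr V by rewrite VM.
rewrite mulmxDl !raddfD /= mul_scalar_mx mxtraceZ -trM mxtrace_scalar => trV.
have m0 : 0 < m%:R :> R by rewrite Hmr ltr0n expn_gt0 r0.
have : r%:R * m%:R <= 2 * (L * m%:R) by move: Htr trV HM; rewrite -[r%:R *+ m]mulr_natr; lra.
by rewrite mulrA ler_pM2r//; lra.
Qed.

End HadamardLower.

(** The largest power of [4] not exceeding [n] is the number of coordinates to
    which the Hadamard argument is applied. *)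
Lemma lip_ext_modulus_ge (R : realType) (n : nat) : (0 < n)%N ->
  ((4^-1 * Num.sqrt n%:R)%:E <= lip_ext_modulus 'rV[R]_n)%E.
Proof.
move=> n0; apply: le_ereal_inf_tmp => -[L| |] [//= L1 ext]; last by rewrite leey.
have /andP[kn nk] := trunc_log_bounds (isT : (1 < 4)%N) n0.
set k := trunc_log 4 n in kn nk.
have mE : hdim k.*2 = (4 ^ k)%N by rewrite hdimE -mul2n expnM.
have r2 : (4 ^ k = (2 ^ k) ^ 2)%N by rewrite -expnM mulnC expnM.
have nE : n = (hdim k.*2 + (n - 4 ^ k))%N by rewrite mE subnKC.
rewrite [X in lip_extendable 'rV[R]_X _]nE in ext.
have rL : (2 ^ k)%:R / 2 <= L.
  apply: (@hadamard_lower R _ (2 ^ k) (hadamard R k.*2)).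
  - by rewrite expn_gt0.
  - by rewrite hadamard_sqr natrX -exprM muln2.
  - by rewrite mE r2.
  - exact: hadamard_trace.
  - exact: hadamard_sign.
  - exact: le_trans ler01 L1.
  - exact: extendable_lshift ext.
rewrite lee_fin; apply: le_trans rL.
have : Num.sqrt n%:R <= 2 * (2 ^ k)%:R :> R.
  rewrite -[leRHS]ger0_norm ?mulr_ge0// -sqrtr_sqr ler_sqrt ?sqr_ge0//.
  by rewrite -natrM -natrX ler_nat expnMn -r2 -expnS ltnW.
lra.
Qed.

Theorem theorem2 (R : realType) :
  exists c C : R, 0 < c /\ 0 < C /\
    forall n : nat, (0 < n)%N ->
      ((c * Num.sqrt (n%:R))%:E <= lip_ext_modulus 'rV[R]_n)%E /\
      (lip_ext_modulus 'rV[R]_n <= (C * Num.sqrt (n%:R))%:E)%E.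
Proof.
exists 4^-1, (27 * expR 1 * (3 * expR 1 + 5)).
have e0 := expR_gt0 (1 : R).
split; first by rewrite invr_gt0.
split; first by rewrite !mulr_gt0// addr_gt0// mulr_gt0.
by move=> n n0; split; [exact: lip_ext_modulus_ge|exact: lip_ext_modulus_le].
Qed.
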